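(* Let $f:\mathbb{R}^n\to\mathbb{R}$ be a convex, continuously differentiable function with locally Lipschitz gradient, with $\mathcal{X}^*:=\arg\min f\neq\emptyset$ and optimal value $f^*$, and assume $f$ is locally strongly convex. Let $x^0$ be such that $\Lambda(x^0):=\{x:f(x)\le f(x^0)\}$ is bounded; let $r:=\max\{\|x\|:x\in\Lambda(x^0)\}$, $\Omega:=\overline{B}(0;5r)$, let $L_\Omega>0$ satisfy $\|\nabla f(x)-\nabla f(y)\|\le L_\Omega\|x-y\|$ on $\Omega$, and let $\mu_\Omega:=\inf_{x,y\in\Omega,x\neq y}\frac{\langle\nabla f(y)-\nabla f(x),y-x\rangle}{\|y-x\|^2}$; assume $\mu_\Omega<L_\Omega$. Let $(x^k)$ be generated by $x^{k+1}=x^k-\alpha_k\nabla f(x^k)$ with $\alpha_k\in[\bar\alpha,1/L_\Omega]$, where $0<\bar\alpha<1/L_\Omega$. Let $x^*$ be an optimal solution, $q_0:=\frac{2\bar\alpha\mu_\Omega L_\Omega}{\mu_\Omega+L_\Omega}$, $q_1:=\frac{\mu_\Omega^2\bar\alpha^2}{4}$. Then: (a) $\|x^{k+1}-x^*\|^2\le(1-q_0)\|x^k-x^*\|^2$ and $f(x^{k+1})-f^*\le(1-q_1)(f(x^k)-f^* )$ for all $k\in\mathbb{N}_0$; i.e. $(\|x^k-x^*\|)$ and $(f(x^k)-f^* )$ converge Q-linearly to $0$ with rates $\sqrt{1-q_0}$ and $1-q_1$; (b) $\|\nabla f(x^k)\|\le\frac{\sqrt2 L_\Omega}{\sqrt{\mu_\Omega}}(f(x^0)-f^*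 )^{1/2}(1-q_1)^{k/2}$ for all $k\in\mathbb{N}_0$.
   Context: $f$ is locally strongly convex if every $x$ has $\delta_x>0$, $\mu_x>0$ such that $f(y)\ge f(z)+\langle\nabla f(z),y-z\rangle+\frac{\mu_x}{2}\|y-z\|^2$ for all $y,z\in B(x;\delta_x)$. Here $\Omega$ is the set $\overline B(0;(1+2(1+\nu)^{1/\nu})r)$ with $\nu=1$. *)

(* Defs.v *)
From HB Require Import structures.
From mathcomp Require Import all_boot all_order all_algebra.
From mathcomp Require Import all_classical all_reals all_analysis.
Set Implicit Arguments. Unset Strict Implicit. Unset Printing Implicit Defensive.
Import Order.TTheory GRing.Theory Num.Theory.
Import numFieldNormedType.Exports.
Local Open Scope ring_scope.
Local Open Scope classical_set_scope.

(* Euclidean inner product and Euclidean norm on R^n (the library norm on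
   matrices is the sup norm, so we define the Euclidean one explicitly). *)
Definition dotv {R : realType} {n : nat} (u v : 'rV[R]_n) : R :=
  \sum_(i < n) u ord0 i * v ord0 i.
Definition enorm {R : realType} {n : nat} (u : 'rV[R]_n) : R :=
  Num.sqrt (dotv u u).

Definition grad {R : realType} {n : nat} (f : 'rV[R]_n -> R) (x : 'rV[R]_n)
  : 'rV[R]_n := \row_(i < n) ('D_(delta_mx ord0 i) f x).

Definition convex_fun {R : realType} {n : nat} (f : 'rV[R]_n -> R) : Prop :=
  forall (x y : 'rV[R]_n) (t : R), 0 <= t <= 1 ->
    f ((1 - t) *: x + t *: y) <= (1 - t) * f x + t * f y.

Definition C1 {R : realType} {n : nat} (f : 'rV[R]_n -> R) : Prop :=
  (forall x, differentiable f x) /\ continuous (grad f).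

Definition locally_lipschitz_grad {R : realType} {n : nat} (f : 'rV[R]_n -> R)
  : Prop :=
  forall x : 'rV[R]_n, exists2 d : R, 0 < d & exists L : R,
    forall y z, enorm (y - x) < d -> enorm (z - x) < d ->
      enorm (grad f y - grad f z) <= L * enorm (y - z).

Definition locally_strongly_convex {R : realType} {n : nat}
  (f : 'rV[R]_n -> R) : Prop :=
  forall x : 'rV[R]_n, exists d : R, exists mu : R, [/\ 0 < d, 0 < mu &
    forall y z, enorm (y - x) < d -> enorm (z - x) < d ->
      f y >= f z + dotv (grad f z) (y - z) + mu / 2 * enorm (y - z) ^+ 2].

Definition cball0 {R : realType} {n : nat} (rho : R) : set 'rV[R]_n :=
  [set x | enorm x <= rho].

Definition mu_on {R : realType} {n : nat} (f : 'rV[R]_n -> R)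
  (Om : set 'rV[R]_n) : R :=
  inf [set q : R | exists x y, [/\ Om x, Om y, x <> y &
        q = dotv (grad f y - grad f x) (y - x) / enorm (y - x) ^+ 2]].

(* Main.v *)
Require Import Defs.
From HB Require Import structures.
From mathcomp Require Import all_boot all_order all_algebra.
From mathcomp Require Import all_classical all_reals all_analysis.
From mathcomp Require Import ring lra.
Import Order.TTheory GRing.Theory Num.Theory.
Import numFieldNormedType.Exports.
Local Open Scope ring_scope.
Local Open Scope classical_set_scope.

(** Co-coercivity of the gradient of [f - mu/2 |.|^2] usually needs the gradient
    step from [y] to stay in the domain, which fails on [Omega] when [L - mu] is
    small. For nearby points the step is short enough, and the resulting inequality
    [|G|^2 + mu L |D|^2 <= (L + mu) <G, D>], with [D = y - x] and [G] the difference
    of gradients, propagates from the two halves of a segment to the whole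
    segment, hence to the ball of radius [r]. The same bisection turns local
    strong convexity, made uniform by compactness, into strong monotonicity on
    [Omega], so that [mu_Omega > 0]. The distance estimate follows by expanding
    the square; the estimate for the values combines the descent lemma with
    [|grad f|^2 >= 2 mu (f - f^* )]. *)

(** * Euclidean geometry: bilinearity, Cauchy-Schwarz, comparison with the sup norm *)

Section Euclidean.
Context {R : realType} {n : nat}.
Implicit Types (u v w : 'rV[R]_n) (a : R).

Lemma dotvC u v : dotv u v = dotv v u.
Proof. by apply: eq_bigr => i _; rewrite mulrC. Qed.

Lemma dotvDl u v w : dotv (u + v) w = dotv u w + dotv v w.
Proof. by rewrite -big_split; apply: eq_bigr => i _; rewrite mxE mulrDl. Qed.

Lemma dotvZl a u v : dotv (a *: u) v = a * dotv u v.
Proof. by rewrite /dotv mulr_sumr; apply: eq_bigr => i _; rewrite mxE mulrA. Qed.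

Lemma dotvDr u v w : dotv w (u + v) = dotv w u + dotv w v.
Proof. by rewrite dotvC dotvDl !(dotvC w). Qed.

Lemma dotvZr a u v : dotv v (a *: u) = a * dotv v u.
Proof. by rewrite dotvC dotvZl (dotvC v). Qed.

Lemma dotvNl u v : dotv (- u) v = - dotv u v.
Proof. by rewrite -scaleN1r dotvZl mulN1r. Qed.

Lemma dotvNr u v : dotv v (- u) = - dotv v u.
Proof. by rewrite dotvC dotvNl (dotvC v). Qed.

Definition dotvE := (dotvDl, dotvDr, dotvZl, dotvZr, dotvNl, dotvNr).

Lemma dotvv_ge0 u : 0 <= dotv u u.
Proof. by apply: sumr_ge0 => i _; rewrite -expr2 sqr_ge0. Qed.

Lemma dotvv_eq0 u : dotv u u = 0 -> u = 0.
Proof.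
move=> /eqP; rewrite psumr_eq0 => [/allP u0|i _]; last by rewrite -expr2 sqr_ge0.
apply/rowP => i; rewrite mxE; apply/eqP.
by have := u0 i (mem_index_enum i); rewrite mulf_eq0 orbb.
Qed.

Lemma enorm_sqr u : enorm u ^+ 2 = dotv u u.
Proof. by rewrite sqr_sqrtr ?dotvv_ge0. Qed.

Lemma enorm_ge0 u : 0 <= enorm u.
Proof. exact: sqrtr_ge0. Qed.

Lemma enorm0 : enorm (0 : 'rV[R]_n) = 0.
Proof. by rewrite /enorm -(scale0r 0) dotvZl mul0r sqrtr0. Qed.

Lemma enorm_eq0 u : enorm u = 0 -> u = 0.
Proof. by move=> u0; apply: dotvv_eq0; rewrite -enorm_sqr u0 expr0n. Qed.

Lemma enormZ a u : enorm (a *: u) = `|a| * enorm u.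
Proof. by rewrite /enorm !dotvE mulrA -expr2 sqrtrM ?sqr_ge0 // sqrtr_sqr. Qed.

Lemma enormN u : enorm (- u) = enorm u.
Proof. by rewrite /enorm !dotvE opprK. Qed.

(** Cauchy-Schwarz: the squared norm of [|v|^2 u - <u, v> v] is nonnegative and equals
    [|v|^2 (|u|^2 |v|^2 - <u, v>^2)]. *)
Lemma dotv_le_enorm u v : dotv u v <= enorm u * enorm v.
Proof.
have [v0|v_neq0] := eqVneq (enorm v) 0.
  rewrite v0 mulr0 (enorm_eq0 _ v0) -(scale0r 0) dotvZr mul0r //.
have v_gt0 : 0 < enorm v by rewrite lt_def v_neq0 enorm_ge0.
have h := dotvv_ge0 (dotv v v *: u - dotv u v *: v).
rewrite !dotvE (dotvC v u) -!enorm_sqr in h.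
set c := dotv u v in h *; set A := enorm u in h *; set B := enorm v in h v_gt0 *.
have A0 : 0 <= A := enorm_ge0 u.
have h2 : 0 <= B ^+ 2 * ((A * B) ^+ 2 - c ^+ 2) by move: h; congr (0 <= _); ring.
rewrite pmulr_rge0 ?exprn_gt0 // subr_ge0 in h2.
rewrite (le_trans (ler_norm c)) // -ler_sqr ?nnegrE ?mulr_ge0 ?(ltW v_gt0) //.
by rewrite real_normK ?num_real.
Qed.

Lemma enormD u v : enorm (u + v) <= enorm u + enorm v.
Proof.
rewrite -ler_sqr ?nnegrE ?addr_ge0 ?enorm_ge0 // enorm_sqr !dotvE (dotvC v u).
have := dotv_le_enorm u v; rewrite sqrrD -!enorm_sqr; lra.
Qed.

Lemma enormB u v : enorm (u - v) <= enorm u + enorm v.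
Proof. by rewrite -(enormN v) enormD. Qed.

Lemma coord_le_enorm u i : `|u ord0 i| <= enorm u.
Proof.
rewrite -ler_sqr ?nnegrE ?enorm_ge0 // real_normK ?num_real // enorm_sqr.
rewrite /dotv (bigD1 i) //= -expr2 lerDl; apply: sumr_ge0 => j _.
by rewrite -expr2 sqr_ge0.
Qed.

(** Links the Euclidean norm to the sup-norm topology. With coordinates within [d / (n + 1)], the
    [n] squares add up to less than [d^2]; taking [n + 1] also covers [n = 0]. *)
Lemma near_enorm u (d : R) : 0 < d -> \forall v \near u, enorm (v - u) < d.
Proof.
move=> d0; apply/nbhs_ballP; exists (d / n.+1%:R) => /=; first by rewrite divr_gt0.
move=> v [_ uv]; rewrite -ltr_sqr ?nnegrE ?enorm_ge0 ?(ltW d0) // enorm_sqr.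
apply: (@le_lt_trans _ _ (\sum_(i < n) (d / n.+1%:R) ^+ 2)).
  apply: ler_sum => i _; rewrite -expr2 -real_normK ?num_real // !mxE.
  have := uv ord0 i; rewrite /ball /= distrC => /ltW h.
  by rewrite ler_sqr // nnegrE ?divr_ge0 ?(ltW d0).
rewrite sumr_const card_ord expr_div_n -[_ *+ n]mulr_natr mulrAC.
rewrite ltr_pdivrMr ?exprn_gt0 // ltr_pM2l ?exprn_gt0 // -natrX ltr_nat.
by rewrite (@leq_trans n.+1) // leq_pmulr.
Qed.

End Euclidean.

(** * Derivatives along lines and an upper Taylor estimate *)

Section Smooth.
Context {R : realType} {n : nat}.
Variable f : 'rV[R]_n -> R.
Hypothesis f_diff : forall x, differentiable f x.
Implicit Types (x y z u v : 'rV[R]_n).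

Lemma derive_grad x v : 'D_v f x = dotv (grad f x) v.
Proof.
rewrite deriveE // [in LHS](row_sum_delta v) linear_sum; apply: eq_bigr => i _.
by rewrite linearZ /= mxE deriveE // mulrC.
Qed.

Lemma is_derive_line x v (t : R) :
  is_derive t 1 (fun s => f (x + s *: v)) (dotv (grad f (x + t *: v)) v).
Proof.
have E : (fun h : R => h^-1 *: (((fun s => f (x + s *: v)) \o shift t) (h *: 1)
    - f (x + t *: v))) =
  (fun h : R => h^-1 *: ((f \o shift (x + t *: v)) (h *: v) - f (x + t *: v))).
  apply/funext => h /=; congr (_ *: (f _ - _)).
  by rewrite scalerDl addrCA [h *: 1]mulr1.
apply: DeriveDef; first by rewrite /derivable E; exact: diff_derivable.
by rewrite -derive_grad /derive E.
Qed.

(* The quadratic [s c + s^2 q / 2] has derivative [c + s q], so it dominates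
   [f (x + s v) - f x] as soon as the derivatives compare. *)
Lemma taylor_le x v (q : R) :
  (forall t, 0 < t < 1 ->
    dotv (grad f (x + t *: v) - grad f x) v <= t * q) ->
  f (x + v) <= f x + dotv (grad f x) v + q / 2.
Proof.
move=> hq; set c := dotv (grad f x) v.
pose phi := fun s : R => f (x + s *: v) - (s * c + s ^+ 2 * (q / 2)).
have dq : forall t : R, is_derive t (1 : R)
    (fun s : R => s * c + s ^+ 2 * (q / 2)) (c + t * q).
  by move=> t; apply: is_derive_eq; rewrite /GRing.scale /=; field.
have dphi : forall t : R,
    is_derive t (1 : R) phi (dotv (grad f (x + t *: v)) v - (c + t * q)).
  move=> t; exact: is_deriveB (is_derive_line x v t) (dq t).
have phic : {within `[0 : R, 1], continuous phi}.
  by apply: derivable_within_continuous => t _; case: (dphi t).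
have [t /itvP t01] := MVT (@ltr01 R) (fun t _ => dphi t) phic.
rewrite subr0 mulr1 /phi scale1r scale0r addr0 => h.
have := hq t; rewrite !t01 => /(_ isT); rewrite !dotvE -/c; lra.
Qed.

End Smooth.

(** * The lower Taylor estimate and the gradient at a minimizer *)

Section SmoothDual.
Context {R : realType} {n : nat}.
Variable f : 'rV[R]_n -> R.
Hypothesis f_diff : forall x, differentiable f x.
Implicit Types (x y z u v : 'rV[R]_n).

Lemma gradN x : grad (fun y => - f y) x = - grad f x.
Proof.
apply/rowP => i; rewrite !mxE; apply: deriveN; exact: diff_derivable.
Qed.

(** This is the upper estimate applied to [- f] and [- q]. *)
Lemma taylor_ge x v (q : R) :
  (forall t, 0 < t < 1 ->
    t * q <= dotv (grad f (x + t *: v) - grad f x) v) ->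
  f x + dotv (grad f x) v + q / 2 <= f (x + v).
Proof.
move=> hq; have fN_diff y : differentiable (fun y => - f y) y by exact: differentiableN.
have := @taylor_le _ _ _ fN_diff x v (- q); rewrite !gradN !dotvE => h.
suff : - f (x + v) <= - f x - dotv (grad f x) v + - q / 2 by lra.
by apply: h => t /hq; rewrite gradN !dotvE; lra.
Qed.

(** On the line through [x] in the direction [v = grad f x], the derivative at parameter [0] is both
    [<v, v>] and zero. *)
Lemma grad_min x : (forall y, f x <= f y) -> grad f x = 0.
Proof.
move=> fx; apply: dotvv_eq0; set v := grad f x.
have dl := is_derive_line _ f_diff x v.
have m11 : (-1 : R) <= 1 by lra.
have m0 : (0 : R) \in (`]-1, 1[%R : interval R) by rewrite in_itv /=; lra.
have := derive1_at_min m11 (fun t _ => @ex_derive _ _ _ _ _ _ _ (dl t)) m0.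
rewrite scale0r addr0 => /(_ (fun t _ => fx _)) d0.
have := dl 0; rewrite scale0r addr0 => d1.
by rewrite -(@derive_val _ _ _ _ _ _ _ d1) (@derive_val _ _ _ _ _ _ _ d0).
Qed.

End SmoothDual.

(** * Bisection, uniform strong monotonicity on balls, and the modulus [mu_on] *)

Section Ball.
Context {R : realType} {n : nat}.
Implicit Types (x y z u v : 'rV[R]_n).

Lemma cball0_segment (rho t : R) x y : 0 <= t <= 1 ->
  cball0 rho x -> cball0 rho y -> cball0 rho (x + t *: (y - x)).
Proof.
move=> t01 xr yr; rewrite /cball0 /=.
have -> : x + t *: (y - x) = (1 - t) *: x + t *: y.
  by apply/rowP => i; rewrite !mxE; ring.
apply: (le_trans (enormD _ _)); rewrite !enormZ !ger0_norm; [|lra..].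
move: xr yr; rewrite /cball0 /= => xr yr.
have : (1 - t) * enorm x <= (1 - t) * rho by rewrite ler_wpM2l //; lra.
have : t * enorm y <= t * rho by rewrite ler_wpM2l //; lra.
lra.
Qed.

(* The quadratic inequality between [D = y - z] and [G y - G z] only improves
   when it is added up over the two halves of a segment. *)
Lemma bisection (K : set 'rV[R]_n) (G : 'rV[R]_n -> 'rV[R]_n) (a b c e : R) :
  0 <= a -> 0 < e ->
  (forall y z, K y -> K z -> K (z + 2^-1 *: (y - z))) ->
  (forall y z, K y -> K z -> enorm (y - z) < e ->
    a * dotv (G y - G z) (G y - G z) + b * dotv (y - z) (y - z)
      <= c * dotv (G y - G z) (y - z)) ->
  forall y z, K y -> K z ->
    a * dotv (G y - G z) (G y - G z) + b * dotv (y - z) (y - z)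
      <= c * dotv (G y - G z) (y - z).
Proof.
move=> a0 e0 midK small.
suff step N : forall y z, K y -> K z -> enorm (y - z) < e * 2 ^+ N ->
    a * dotv (G y - G z) (G y - G z) + b * dotv (y - z) (y - z)
      <= c * dotv (G y - G z) (y - z).
  (* Any [N] above [|y - z| / e] is enough, because [N < 2 ^ N]. *)
  move=> y z Ky Kz; apply: (step (Num.truncn (enorm (y - z) / e)).+1) => //.
  rewrite mulrC -ltr_pdivrMr //; apply: (lt_trans (Num.Theory.truncnS_gt _)).
  by rewrite -natrX ltr_nat ltn_expl.
elim: N => [y z Ky Kz|N IH y z Ky Kz yz]; first by rewrite expr0 mulr1; exact: small.
have Km := midK _ _ Ky Kz; set m := z + _ in Km.
have ym : y - m = 2^-1 *: (y - z) by apply/rowP => i; rewrite !mxE; field.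
have mz : m - z = 2^-1 *: (y - z) by apply/rowP => i; rewrite !mxE; field.
have close : enorm (2^-1 *: (y - z)) < e * 2 ^+ N.
  by rewrite enormZ ger0_norm ?invr_ge0 // mulrC ltr_pdivrMr // -mulrA -exprSr.
have := IH y m Ky Km; rewrite ym => /(_ close).
have := IH m z Km Kz; rewrite mz => /(_ close).
have -> : G y - G z = (G y - G m) + (G m - G z) by rewrite addrA subrK.
set g1 := G y - G m; set g2 := G m - G z; set D := y - z.
(* By the parallelogram identity, [|g1 + g2|^2] is at most [2 (|g1|^2 + |g2|^2)], so twice the sum
   of the two halves gives the claim; this is where [0 <= a] enters. *)
have := mulr_ge0 a0 (dotvv_ge0 (g1 - g2)).
by clearbody g1 g2 D; rewrite !dotvE (dotvC g2 g1); lra.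
Qed.

(** A single [e] serves as closeness radius and as modulus. Compactness of a cube containing the
    ball makes it uniform, and bisection with [a = 0] then removes the closeness condition. *)
Lemma strongly_monotone_ball (f : 'rV[R]_n -> R) (rho : R) :
  locally_strongly_convex f ->
  exists2 e : R, 0 < e & forall y z, cball0 rho y -> cball0 rho z ->
    e * dotv (y - z) (y - z) <= dotv (grad f y - grad f z) (y - z).
Proof.
move=> fsc.
pose P (e : R) z := forall y, enorm (y - z) < e ->
  e * dotv (y - z) (y - z) <= dotv (grad f y - grad f z) (y - z).
pose K := [set v : 'rV[R]_n | forall i, [set` `[- rho, rho]%R] (v ord0 i)].
have Kcompact : compact K.
  by apply: (@rV_compact _ _ (fun=> [set` `[- rho, rho]%R])) => i; exact: segment_compact.
have ballK z : cball0 rho z -> K z.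
  move=> zr i; rewrite /= in_itv /= -ler_norml.
  exact: le_trans (coord_le_enorm _ _) zr.
have nearP : \forall e \near (0 : R)^'+, K `<=` P e.
  move/compact_near_coveringP: Kcompact; apply=> x _.
  have [d [mu [d0 mu0 dmu]]] := fsc x.
  have d20 : 0 < d / 2 by rewrite divr_gt0.
  (* Halving [d] keeps [y] within [d] of [x] when [z] is near [x] and [y] is within [e] of [z]. *)
  exists ([set z | enorm (z - x) < d / 2], [set e : R | e < d / 2 /\ e < mu]).
    split; first exact: near_enorm.
    by apply: filterI; apply: nbhs_right_lt.
  move=> [z e] /= [zx [ed emu]] y yz.
  have yx : enorm (y - x) < d.
    by rewrite -(subrK z y) -addrA (le_lt_trans (enormD _ _)) //; lra.
  have zx' : enorm (z - x) < d by lra.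
  (* The values of [f] cancel in the sum of the two inequalities, and the two halves of [mu] add
     up. *)
  have := dmu y z yx zx'; have := dmu z y zx' yx.
  rewrite -(opprB y z) enormN enorm_sqr.
  have : e * dotv (y - z) (y - z) <= mu * dotv (y - z) (y - z).
    by rewrite ler_wpM2r ?dotvv_ge0 // ltW.
  by rewrite (dotvDl (grad f y)) dotvNl dotvNr; lra.
have [e [eP e0]] := @filter_ex _ ((0 : R)^'+) _ _ (filterI nearP (nbhs_right_gt 0)).
exists e => // y z yr zr.
have := @bisection (cball0 rho) (grad f) 0 e 1 e (lexx _) e0 _ _ y z yr zr.
rewrite mul0r add0r mul1r; apply.
  by move=> u v ur vr; apply: cball0_segment => //; lra.
move=> u v ur vr uv; rewrite mul0r add0r mul1r; apply: eP => //; exact: ballK.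
Qed.

(** Monotonicity bounds the quotients below by [0], so [inf] is a genuine infimum; the case [y = z]
    is separate. *)
Lemma mu_on_le (f : 'rV[R]_n -> R) (K : set 'rV[R]_n) :
  (forall y z, K y -> K z -> 0 <= dotv (grad f y - grad f z) (y - z)) ->
  forall y z, K y -> K z ->
    mu_on f K * dotv (y - z) (y - z) <= dotv (grad f y - grad f z) (y - z).
Proof.
move=> mono y z Ky Kz.
have [->|yz] := eqVneq y z; first by rewrite subrr -(scale0r 0) !dotvZr !mul0r mulr0.
have D0 : 0 < dotv (y - z) (y - z).
  rewrite lt_def dotvv_ge0 andbT; apply: contra yz => /eqP /dotvv_eq0 h.
  by rewrite -subr_eq0 h.
rewrite -ler_pdivlMr //; apply: ge_inf.
  exists 0 => _ [u [v [Ku Kv _ ->]]]; apply: divr_ge0; first exact: mono.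
  by rewrite enorm_sqr dotvv_ge0.
exists z, y; split=> //; last by rewrite enorm_sqr.
by move=> zy; rewrite zy eqxx in yz.
Qed.

(** The distinct points [u] and [v] make the set of quotients nonempty, which excludes the default
    value of [inf]. *)
Lemma mu_on_ge (f : 'rV[R]_n -> R) (K : set 'rV[R]_n) (e : R) u v :
  K u -> K v -> u <> v ->
  (forall y z, K y -> K z ->
    e * dotv (y - z) (y - z) <= dotv (grad f y - grad f z) (y - z)) ->
  e <= mu_on f K.
Proof.
move=> Ku Kv uv he; apply: lb_le_inf.
  by exists (dotv (grad f v - grad f u) (v - u) / enorm (v - u) ^+ 2), u, v.
move=> _ [y [z [Ky Kz yz ->]]]; rewrite enorm_sqr ler_pdivlMr; first exact: he.
rewrite lt_def dotvv_ge0 andbT; apply/eqP => /dotvv_eq0 /eqP.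
by rewrite subr_eq0 => /eqP zy; apply: yz.
Qed.

End Ball.

(** * Quadratic bounds and co-coercivity on a ball *)

Section SmoothStronglyConvex.
Context {R : realType} {n : nat}.
Variables (f : 'rV[R]_n -> R) (rho L mu : R).
Hypothesis f_diff : forall x, differentiable f x.
Hypothesis lip : forall y z, cball0 rho y -> cball0 rho z ->
  enorm (grad f y - grad f z) <= L * enorm (y - z).
Hypothesis mono : forall y z, cball0 rho y -> cball0 rho z ->
  mu * dotv (y - z) (y - z) <= dotv (grad f y - grad f z) (y - z).
Implicit Types (x y z u v : 'rV[R]_n).

Lemma strong_convexity_ball x y : cball0 rho x -> cball0 rho y ->
  f x + dotv (grad f x) (y - x) + mu / 2 * dotv (y - x) (y - x) <= f y.
Proof.
move=> xr yr; set D := y - x.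
rewrite [X in _ <= f X](_ : y = x + D); last by rewrite addrC subrK.
rewrite mulrAC; apply: taylor_ge => // t t01.
have zr : cball0 rho (x + t *: D) by apply: cball0_segment => //; lra.
have t0 : 0 < t by lra.
have := mono _ _ zr xr; rewrite addrAC subrr add0r.
by rewrite !(dotvZl t, dotvZr t) (mulrCA mu t) ler_pM2l // mulrCA.
Qed.

Lemma descent_ball x y : cball0 rho x -> cball0 rho y ->
  f y <= f x + dotv (grad f x) (y - x) + L / 2 * dotv (y - x) (y - x).
Proof.
move=> xr yr; set D := y - x.
rewrite [X in f X <= _](_ : y = x + D); last by rewrite addrC subrK.
rewrite (mulrAC L); apply: taylor_le => // t t01.
have zr : cball0 rho (x + t *: D) by apply: cball0_segment => //; lra.
have t0 : 0 < t by lra.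
apply: (le_trans (dotv_le_enorm _ _)); rewrite -enorm_sqr expr2 !mulrA.
rewrite ler_wpM2r ?enorm_ge0 //; apply: (le_trans (lip _ _ zr xr)).
by rewrite addrAC subrr add0r enormZ gtr0_norm // mulrA (mulrC t).
Qed.

(* Both points are pushed by a step [t w], where [w] is the gradient difference
   of the convex function [f - mu/2 |.|^2], whose gradient is co-coercive with
   modulus [t = 1/(L - mu)]. *)
Lemma cocoercive_step x y (t : R) :
  let w := (grad f y - grad f x) - mu *: (y - x) in
  0 < t -> (L - mu) * t = 1 -> cball0 rho x -> cball0 rho y ->
  cball0 rho (y - t *: w) -> cball0 rho (x + t *: w) ->
  1 * dotv (grad f y - grad f x) (grad f y - grad f x)
    + mu * L * dotv (y - x) (y - x)
    <= (L + mu) * dotv (grad f y - grad f x) (y - x).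
Proof.
move=> w t0 Lmut xr yr zr z'r.
have h1 := strong_convexity_ball _ _ xr zr.
have h2 := descent_ball _ _ yr zr.
have h3 := strong_convexity_ball _ _ yr z'r.
have h4 := descent_ball _ _ xr z'r.
have e1 : y - t *: w - y = - (t *: w) by rewrite addrAC subrr add0r.
have e2 : x + t *: w - x = t *: w by rewrite addrAC subrr add0r.
have e3 : y - t *: w - x = (y - x) - t *: w by rewrite addrAC.
have e4 : x + t *: w - y = - ((y - x) - t *: w) by rewrite opprB opprB addrA [x + _]addrC.
rewrite e1 e2 e3 e4 in h1 h2 h3 h4.
set D := y - x in w zr z'r h1 h2 h3 h4 e1 e2 e3 e4 *.
set G := grad f y - grad f x in w zr z'r h1 h2 h3 h4 e1 e2 e3 e4 *.
have hG : dotv (grad f y) (D - t *: w) = dotv (grad f x) (D - t *: w)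
     + dotv G (D - t *: w) by rewrite -dotvDl /G [grad f x + _]addrC subrK.
have hG2 : dotv (grad f y) (t *: w) = dotv (grad f x) (t *: w)
     + dotv G (t *: w) by rewrite -dotvDl /G [grad f x + _]addrC subrK.
clear e1 e2 e3 e4 zr z'r; clearbody D G.
have key : dotv w w * t <= dotv w D.
  have hw : dotv G D = dotv w D + mu * dotv D D by rewrite /w !dotvE; ring.
  have hw2 : dotv G w = dotv w w + mu * dotv w D.
    by rewrite /w !dotvE (dotvC D G); ring.
  clearbody w.
  rewrite !(dotvNr, dotvNl) !opprK in h1 h2 h3 h4.
  (* Adding [h1] to [h4] eliminates all values of [f]. Since [(L - mu) t = 1], what is left is
     [t |w|^2 <= <w, D>]. *)
  have h : - dotv G (D - t *: w) + dotv G (t *: w)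
     + mu * dotv (D - t *: w) (D - t *: w) <= L * dotv (t *: w) (t *: w) by lra.
  rewrite !(dotvDr, dotvDl, dotvNl, dotvNr, dotvZl, dotvZr) (dotvC D w) hw hw2 in h.
  have : (L - mu) * t * (t * dotv w w) = t * dotv w w by rewrite Lmut mul1r.
  lra.
have Lmu0 : 0 < L - mu by rewrite -(pmulr_lgt0 _ t0) Lmut.
have key2 : dotv w w <= (L - mu) * dotv w D.
  by rewrite -[leLHS]mul1r -Lmut -mulrA ler_pM2l // mulrC.
move: key2; rewrite /w !(dotvDr, dotvDl, dotvNl, dotvNr, dotvZl, dotvZr) (dotvC D G).
lra.
Qed.

(** The margin [rho - sigma] must contain the step [t w]. As [|w| <= (L + mu) |u - v|], this holds
    for points closer than [(rho - sigma) / (t (L + mu))], and bisection does the rest. *)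
Lemma cocoercive_ball (sigma : R) x y : 0 <= mu -> mu < L -> sigma < rho ->
  cball0 sigma x -> cball0 sigma y ->
  dotv (grad f y - grad f x) (grad f y - grad f x)
    + mu * L * dotv (y - x) (y - x)
    <= (L + mu) * dotv (grad f y - grad f x) (y - x).
Proof.
move=> mu0 muL sr xs ys; rewrite -[X in X + _]mul1r.
pose t := (L - mu)^-1.
have t0 : 0 < t by rewrite invr_gt0 subr_gt0.
have Lt : (L - mu) * t = 1 by rewrite mulfV // subr_eq0 gt_eqF.
have c0 : 0 < t * (L + mu) by rewrite mulr_gt0 //; lra.
have e0 : 0 < (rho - sigma) / (t * (L + mu)) by rewrite divr_gt0 // subr_gt0.
apply: (@bisection _ _ (cball0 sigma) (grad f) 1 (mu * L) (L + mu) _ ler01 e0) => //.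
  by move=> u v us vs; apply: cball0_segment => //; lra.
move=> u v us vs uv.
have ur : cball0 rho u by rewrite /cball0 /= (le_trans us) // ltW.
have vr : cball0 rho v by rewrite /cball0 /= (le_trans vs) // ltW.
set w := (grad f u - grad f v) - mu *: (u - v).
have wle : enorm (t *: w) <= rho - sigma.
  rewrite enormZ gtr0_norm //.
  have : enorm w <= (L + mu) * enorm (u - v).
    apply: (le_trans (enormB _ _)); rewrite enormZ ger0_norm //.
    by have := lip _ _ ur vr; lra.
  rewrite -(ler_pM2l t0) mulrA => /le_trans; apply.
  by rewrite mulrC -ler_pdivlMr // ltW.
apply: (@cocoercive_step v u t) => //; rewrite /cball0 /= -/w.
  by apply: (le_trans (enormB _ _)); move: us; rewrite /cball0 /=; lra.
by apply: (le_trans (enormD _ _)); move: vs; rewrite /cball0 /=; lra.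
Qed.

End SmoothStronglyConvex.

(** * One step of the gradient method from a point of norm at most [r] *)

Section GradientMethod.
Context {R : realType} {n : nat}.
Variables (f : 'rV[R]_n -> R) (r L mu abar : R) (xs : 'rV[R]_n).
Hypothesis f_diff : forall x, differentiable f x.
Hypothesis r_gt0 : 0 < r.
Hypothesis L_gt0 : 0 < L.
Hypothesis mu_gt0 : 0 < mu.
Hypothesis muL : mu < L.
Hypothesis lip : forall y z, cball0 (5 * r) y -> cball0 (5 * r) z ->
  enorm (grad f y - grad f z) <= L * enorm (y - z).
Hypothesis mono : forall y z, cball0 (5 * r) y -> cball0 (5 * r) z ->
  mu * dotv (y - z) (y - z) <= dotv (grad f y - grad f z) (y - z).
Hypothesis xs_min : forall y, f xs <= f y.
Hypothesis xs_r : enorm xs <= r.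
Implicit Types (x y z : 'rV[R]_n).

Let ball5 x : enorm x <= r -> cball0 (5 * r) x.
Proof. by rewrite /cball0 /=; move: r_gt0; lra. Qed.

Let grad_xs : grad f xs = 0. Proof. exact: grad_min. Qed.

Lemma enorm_grad_le x : enorm x <= r -> enorm (grad f x) <= L * enorm (x - xs).
Proof. by move=> xr; have := lip _ _ (ball5 _ xr) (ball5 _ xs_r); rewrite grad_xs subr0. Qed.

Lemma quadratic_growth x : enorm x <= r ->
  mu / 2 * enorm (x - xs) ^+ 2 <= f x - f xs.
Proof.
move=> xr; have := strong_convexity_ball _ _ _ f_diff mono _ _ (ball5 _ xs_r) (ball5 _ xr).
by rewrite grad_xs -[0](scale0r 0) dotvZl enorm_sqr; lra.
Qed.

(** Strong convexity bounds [f xs] below by a quadratic in [D = xs - x], whose minimum over all [D]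
    is read off from [|g + mu D|^2 >= 0]. *)
Lemma gradient_dominated x : enorm x <= r ->
  2 * mu * (f x - f xs) <= dotv (grad f x) (grad f x).
Proof.
move=> xr; have := strong_convexity_ball _ _ _ f_diff mono _ _ (ball5 _ xr) (ball5 _ xs_r).
set D := xs - x; set g := grad f x => h.
have := dotvv_ge0 (g + mu *: D); clearbody D g.
rewrite !dotvE (dotvC D g) => h2.
have : 2 * mu * (f x + dotv g D + mu / 2 * dotv D D) <= 2 * mu * f xs.
  by rewrite ler_pM2l // mulr_gt0.
lra.
Qed.

(** The step has length at most [a L |x - xs| <= 2 r], so it ends in the ball of radius [3 r], where
    the descent lemma applies. *)
Lemma sufficient_decrease x a : enorm x <= r -> 0 < a -> a * L <= 1 ->
  f (x - a *: grad f x) <= f x - a / 2 * dotv (grad f x) (grad f x).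
Proof.
move=> xr a0 aL.
have zr : cball0 (5 * r) (x - a *: grad f x).
  apply: (le_trans (enormB _ _)); rewrite enormZ gtr0_norm //.
  have : a * enorm (grad f x) <= a * (L * (r + r)).
    rewrite ler_pM2l //; apply: (le_trans (enorm_grad_le _ xr)).
    by rewrite ler_pM2l // (le_trans (enormB _ _)) // lerD.
  have : a * L * (r + r) <= 1 * (r + r) by rewrite ler_wpM2r //; move: r_gt0; lra.
  by move: r_gt0; lra.
have := descent_ball _ _ _ f_diff lip _ _ (ball5 _ xr) zr.
rewrite [x - _ - x]addrAC subrr add0r; set g := grad f x; clearbody g; rewrite !dotvE.
have := dotvv_ge0 g; set A := dotv g g => A0.
have : a * L * (a * A) <= 1 * (a * A) by rewrite ler_wpM2r // mulr_ge0 // ltW.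
lra.
Qed.

Lemma gradient_step_dist x a : enorm x <= r -> 0 < abar -> abar <= a -> a * L <= 1 ->
  enorm (x - a *: grad f x - xs) ^+ 2
    <= (1 - 2 * abar * mu * L / (mu + L)) * enorm (x - xs) ^+ 2.
Proof.
move=> xr ab0 aba aL.
have a0 : 0 < a by lra.
have r5 : r < 5 * r by move: r_gt0; lra.
have := cocoercive_ball _ _ _ _ f_diff lip mono _ _ _ (ltW mu_gt0) muL r5 xs_r xr.
rewrite grad_xs subr0 addrAC !enorm_sqr.
set g := grad f x; set D := x - xs; clearbody g D => h.
have -> : dotv (D - a *: g) (D - a *: g)
    = dotv D D - 2 * a * dotv g D + a ^+ 2 * dotv g g.
  by rewrite !dotvE (dotvC D g); ring.
have S0 : 0 < mu + L by rewrite addr_gt0.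
rewrite -subr_ge0 -(pmulr_rge0 _ S0).
set gg := dotv g g in h *; set gd := dotv g D in h *; set dd := dotv D D in h *.
(* The slack splits into three nonnegative terms, due to [abar <= a], co-coercivity, and
   [a (mu + L) <= 2]. *)
have -> : (mu + L) * ((1 - 2 * abar * mu * L / (mu + L)) * dd
    - (dd - 2 * a * gd + a ^+ 2 * gg))
  = 2 * (a - abar) * (mu * L * dd)
    + 2 * a * ((L + mu) * gd - (gg + mu * L * dd))
    + a * (2 - a * (mu + L)) * gg.
  by field; rewrite gt_eqF.
have gg0 : 0 <= gg := dotvv_ge0 g.
have dd0 : 0 <= dd := dotvv_ge0 D.
have aS : a * (mu + L) <= 2 by have : a * mu <= a * L := ler_wpM2l (ltW a0) (ltW muL); lra.
have c1 : 0 <= 2 * (a - abar) by lra.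
have c2 : 0 <= 2 * a by lra.
have c3 : 0 <= a * (2 - a * (mu + L)) by rewrite mulr_ge0 ?subr_ge0 // ltW.
have c4 : 0 <= mu * L * dd by rewrite !mulr_ge0 // ltW.
have c5 : 0 <= (L + mu) * gd - (gg + mu * L * dd) by rewrite subr_ge0.
by rewrite !addr_ge0 ?(mulr_ge0 c1) ?(mulr_ge0 c2) ?(mulr_ge0 c3).
Qed.

Lemma gradient_step_value x a : enorm x <= r -> 0 < abar -> abar <= a -> a * L <= 1 ->
  f (x - a *: grad f x) - f xs <= (1 - mu ^+ 2 * abar ^+ 2 / 4) * (f x - f xs).
Proof.
move=> xr ab0 aba aL.
have a0 : 0 < a by lra.
have h1 := sufficient_decrease _ _ xr a0 aL.
have h2 := gradient_dominated _ xr.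
have F0 : 0 <= f x - f xs by rewrite subr_ge0.
have am0 : 0 < abar * mu by rewrite mulr_gt0.
have am1 : abar * mu <= 1.
  by apply: le_trans aL; apply: ler_pM => //; apply: ltW.
have h3 : a / 2 * (2 * mu * (f x - f xs)) <= a / 2 * dotv (grad f x) (grad f x).
  by rewrite ler_pM2l // divr_gt0.
have h4 : abar * (mu * (f x - f xs)) <= a * (mu * (f x - f xs)).
  by rewrite ler_wpM2r // mulr_ge0 // ltW.
(* The argument yields the factor [1 - abar mu]; the stated one is weaker because [abar mu <= 1]. *)
have h5 : mu ^+ 2 * abar ^+ 2 / 4 * (f x - f xs) <= abar * mu * (f x - f xs).
  by rewrite ler_wpM2r //; nra.
lra.
Qed.

(** The gradient is at most [L |x - xs|], and quadratic growth gives
    [|x - xs|^2 <= (2 / mu) (f x - f xs)]. *)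
Lemma enorm_grad_le_gap x : enorm x <= r ->
  enorm (grad f x) <= Num.sqrt 2 * L / Num.sqrt mu * Num.sqrt (f x - f xs).
Proof.
move=> xr; apply: (le_trans (enorm_grad_le _ xr)).
rewrite [X in _ <= X](_ : _ = L * Num.sqrt (2 / mu * (f x - f xs))).
  rewrite ler_pM2l // -[leLHS]ger0_norm ?enorm_ge0 // -sqrtr_sqr ler_wsqrtr //.
  have := quadratic_growth _ xr; rewrite -(ler_pM2l (_ : 0 < 2 / mu)) ?divr_gt0 //.
  by congr (_ <= _); field; rewrite gt_eqF.
rewrite sqrtrM ?divr_ge0 ?(ltW mu_gt0) // sqrtrM // sqrtrV ?(ltW mu_gt0) //.
by rewrite !mulrA (mulrC L).
Qed.

End GradientMethod.

(** * Iteration of the one-step estimates along the sequence *)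

Theorem theorem3p16 (R : realType) (n : nat) (f : 'rV[R]_n -> R)
  (x0 xs : 'rV[R]_n) (r LO abar : R) (alpha : nat -> R) (x : nat -> 'rV[R]_n) :
  convex_fun f ->
  C1 f ->
  locally_lipschitz_grad f ->
  (exists xm : 'rV[R]_n, forall y, f xm <= f y) ->
  locally_strongly_convex f ->
  (* the level set Lambda(x0) is bounded and r is the max of the norm on it *)
  (exists M : R, forall y, f y <= f x0 -> enorm y <= M) ->
  (exists2 y, f y <= f x0 & enorm y = r) ->
  (forall y, f y <= f x0 -> enorm y <= r) ->
  (* Omega = closed ball B(0; 5 r), L_Omega Lipschitz constant on Omega *)
  0 < LO ->
  (forall y z, cball0 (5 * r) y -> cball0 (5 * r) z ->
     enorm (grad f y - grad f z) <= LO * enorm (y - z)) ->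
  mu_on f (cball0 (5 * r)) < LO ->
  (* gradient method *)
  0 < abar -> abar < 1 / LO ->
  (forall k, abar <= alpha k <= 1 / LO) ->
  x 0%N = x0 ->
  (forall k, x k.+1 = x k - alpha k *: grad f (x k)) ->
  (* x* optimal *)
  (forall y, f xs <= f y) ->
  let muO := mu_on f (cball0 (5 * r)) in
  let fstar := f xs in
  let q0 := 2 * abar * muO * LO / (muO + LO) in
  let q1 := muO ^+ 2 * abar ^+ 2 / 4 in
  (forall k : nat,
      enorm (x k.+1 - xs) ^+ 2 <= (1 - q0) * enorm (x k - xs) ^+ 2 /\
      f (x k.+1) - fstar <= (1 - q1) * (f (x k) - fstar)) /\
  (forall k : nat,
      enorm (grad f (x k)) <=
        Num.sqrt 2 * LO / Num.sqrt muO * Num.sqrt (f x0 - fstar)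
        * (1 - q1) `^ (k%:R / 2)).
Proof.
move=> _ [f_diff _] _ _ fsc _ [y0 y0_le y0_r] r_max LO_gt0 lip muL abar_gt0 abarL
  alphaP x0E xS xs_min muO fstar q0 q1.
have xs_r : enorm xs <= r by exact: r_max.
have r_ge0 : 0 <= r by rewrite -y0_r enorm_ge0.
(* If [r = 0], the level set is [{0}] and [muO] is the infimum of an empty set; all iterates equal
   [xs], and the claims hold whatever [muO] is. *)
have [r0|r_neq0] := eqVneq r 0.
  have level0 y : f y <= f x0 -> y = 0.
    move=> /r_max; rewrite r0 => y_le0; apply: enorm_eq0.
    by apply/eqP; rewrite eq_le y_le0 enorm_ge0.
  have xk k : x k = xs.
    elim: k => [|k IH]; first by rewrite x0E (level0 x0 (lexx _)) (level0 xs (xs_min x0)).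
    by rewrite xS IH grad_min // scaler0 subr0.
  split=> k; rewrite !xk ?grad_min // ?subrr enorm0 ?expr0n ?mulr0 //.
  by rewrite mulr_ge0 ?powR_ge0 // !mulr_ge0 ?invr_ge0 ?sqrtr_ge0 // ltW.
have r_gt0 : 0 < r by rewrite lt_def r_neq0 r_ge0.
have [e e_gt0 e_mono] := strongly_monotone_ball f (5 * r) fsc.
have muO_gt0 : 0 < muO.
  apply: (lt_le_trans e_gt0); apply: (@mu_on_ge _ _ _ _ _ 0 y0) => //.
  - by rewrite /cball0 /= enorm0 mulr_ge0.
  - by rewrite /cball0 /= y0_r ler_peMl //; lra.
  - by move=> y00; rewrite -y00 enorm0 in y0_r; rewrite -y0_r eqxx in r_neq0.
have mono := mu_on_le f (cball0 (5 * r)) (fun y z yr zr =>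
  le_trans (mulr_ge0 (ltW e_gt0) (dotvv_ge0 _)) (e_mono y z yr zr)).
have alpha_ge k : abar <= alpha k by case/andP: (alphaP k).
have alphaL k : alpha k * LO <= 1.
  by rewrite -ler_pdivlMr //; case/andP: (alphaP k).
have subq1_ge0 : 0 <= 1 - q1.
  have : 0 < muO * abar by rewrite mulr_gt0.
  have : muO * abar <= LO * abar by rewrite ler_pM2r // ltW.
  have : LO * abar < 1 by rewrite mulrC -ltr_pdivlMr.
  rewrite /q1; nra.
(* Decrease keeps the iterates in the level set, hence in the ball of radius [r] required by each
   one-step estimate. *)
have level k : f (x k) <= f x0.
  elim: k => [|k IH]; first by rewrite x0E.
  have ak : 0 < alpha k := lt_le_trans abar_gt0 (alpha_ge k).
  have := sufficient_decrease _ _ _ _ f_diff r_gt0 LO_gt0 lip xs_min xs_r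
    _ _ (r_max _ IH) ak (alphaL k).
  rewrite -xS => dec; apply: (le_trans dec); apply: le_trans IH.
  by rewrite gerBl mulr_ge0 ?dotvv_ge0 // divr_ge0 // ltW.
have xr k := r_max _ (level k).
have value k : f (x k.+1) - fstar <= (1 - q1) * (f (x k) - fstar).
  rewrite xS; exact: (@gradient_step_value _ _ f r LO).
have dist k : enorm (x k.+1 - xs) ^+ 2 <= (1 - q0) * enorm (x k - xs) ^+ 2.
  rewrite xS; exact: (@gradient_step_dist _ _ f r LO).
clearbody q1.
have gap k : f (x k) - fstar <= (1 - q1) ^+ k * (f x0 - fstar).
  elim: k => [|k IH]; first by rewrite x0E mul1r.
  by apply: (le_trans (value k)); rewrite exprS -mulrA ler_wpM2l.
split=> // k.
have grad_gap := enorm_grad_le_gap _ _ _ _ _ f_diff r_gt0 LO_gt0 muO_gt0 lip mono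
  xs_min xs_r _ (xr k).
apply: (le_trans grad_gap); rewrite -[leRHS]mulrA ler_wpM2l //.
  by rewrite !mulr_ge0 ?invr_ge0 ?sqrtr_ge0 // ltW.
(* The real power with exponent [k / 2] is the square root of [(1 - q1) ^+ k], so [gap] applies
   under the root. *)
rewrite powRrM powR_mulrn // powR12_sqrt ?exprn_ge0 // mulrC.
by rewrite -sqrtrM ?exprn_ge0 // ler_wsqrtr.
Qed.
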